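(* Let $n\ge 3$ and $1\le k\le n-2$ be integers, let $d$ be an integer with $0\le d\le (n+k-3)/2$, and let $t\in\{1,\ldots,n-1\}$. Put $i_d=\max\{1,d-k+2\}$ and $i_0=\lfloor (n-k+1)/2\rfloor$. If $G$ is an $n$-vertex graph with minimum degree $\delta(G)\ge d$ that is not $k$-connected, then $$s_t(G)\le\begin{cases} s_t(H_n^{k}(i_d)) & \text{for } t=1,\\ \max\{s_t(H_n^{k}(i_d)),\,s_t(H_n^{k}(i_0))\} & \text{for } 2\le t\le n-1,\end{cases}$$ and this bound is tight: for all such $n,k,d,t$ there is an $n$-vertex graph with minimum degree at least $d$ that is not $k$-connected and for which equality holds.
   Context: All graphs are finite and simple. $K_m$ is the complete graph on $m$ vertices; $\cup$ denotes disjoint union, and $A+B$ denotes the join (disjoint union together with all edges between $A$ and $B$). For integers $n,k,i$ with $1\le k\le n-2$ and $1\le i\le\frac{n-k+1}{2}$, define $H_n^{k}(i)=K_{k-1}+(K_i\cup K_{n-k-i+1})$; when $k=1$ this is $K_i\cup K_{n-i}$. For $t\ge 1$, $s_t(G)$ is the number of $t$-stars (copies of $K_{1,t}$) in $G$: $s_t(G)=\sum_{v\in V(G)}\binom{d(v)}{t}$ for $t\ge 2$, and $s_1(G)=e(G)=\frac12\sum_v d(v)$. A graph is $k$-connected if it has more than $k$ vertices and remains connected after deleting any fewer than $k$ vertices. *)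

(* Defs.v *)
From mathcomp Require Import all_boot.

Set Implicit Arguments.
Unset Strict Implicit.
Unset Printing Implicit Defensive.

Record sgraph (T : finType) := SGraph {
  adj :> rel T;
  adj_sym : symmetric adj;
  adj_irr : irreflexive adj
}.

Section Graphs.
Variable T : finType.
Implicit Types (G : sgraph T) (v : T).

Definition nbhd G v : {set T} := [set x | G v x].

Definition deg G v : nat := #|nbhd G v|.

(* Every degree is below #|T|, so on a nonempty T the default value #|T| of
   the iterated minimum is never attained. *)
Definition min_degree G : nat := \big[minn/#|T|]_(v : T) deg G v.

Definition edges G : {set {set T}} := [set [set e.1; e.2] | e : T * T & G e.1 e.2].

Definition connected G : bool := [forall x, forall y, connect G x y].

End Graphs.

Section Induced.
Variable T : finType.
Variables (G : sgraph T) (A : {set T}).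

Definition induced_adj : rel {x : T | x \in A} :=
  [rel x y | G (val x) (val y)].

Fact induced_sym : symmetric induced_adj.
Proof. by move=> x y; exact: adj_sym. Qed.

Fact induced_irr : irreflexive induced_adj.
Proof. by move=> x; exact: adj_irr. Qed.

Definition induced : sgraph {x : T | x \in A} := SGraph induced_sym induced_irr.
End Induced.

Section Stars.
Variable T : finType.
Implicit Types (G : sgraph T) (v x y : T) (A S : {set T}) (F : {set {set T}}).

Definition k_connected (k : nat) G : bool :=
  (k < #|T|) && [forall S : {set T}, (#|S| < k) ==> connected (induced G (~: S))].

Definition star v A : {set {set T}} := [set [set v; x] | x in A].

(* For t >= 1 a copy of K_{1,t} has no isolated vertex, so it is determined by
   its edge set; for t = 1 the two choices of centre give the same copy. *)
Definition stars (t : nat) G : {set {set {set T}}} :=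
  [set F : {set {set T}} | (F \subset edges G) &&
     [exists v : T, exists A : {set T},
        [&& v \notin A, #|A| == t & F == star v A]]].

Definition num_stars (t : nat) G : nat := #|stars t G|.

Lemma set2_inj v x y : [set v; x] = [set v; y] -> x = y.
Proof.
move=> E; have := set22 v x; rewrite E !inE => /orP[/eqP xv|/eqP//].
by have := set22 v y; rewrite -E !inE xv orbb => /eqP.
Qed.

Lemma mem_edges G x y : ([set x; y] \in edges G) = G x y.
Proof.
apply/imsetP/idP => [[[a b]]|Gxy]; last by exists (x, y); rewrite ?inE.
rewrite inE /= => Gab E.
have := set21 x y; have := set22 x y; rewrite E !inE.
have ab : a != b by apply: contraTneq Gab => ->; rewrite adj_irr.
have xy : x != y.
  apply: contraNneq ab => xy; move: E; rewrite -xy setUid => E.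
  have := set21 a b; have := set22 a b; rewrite -E !inE.
  by move=> /eqP-> /eqP->.
case/orP=> /eqP Ey /orP[]/eqP Ex; rewrite Ex Ey // ?adj_irr.
- by rewrite Ex Ey eqxx in xy.
- by rewrite adj_sym.
- by rewrite Ex Ey eqxx in xy.
Qed.

Lemma star_sub G v A : (star v A \subset edges G) = (A \subset nbhd G v).
Proof.
apply/subsetP/subsetP => [H x Ax|H e /imsetP[x Ax ->]].
  by rewrite inE -mem_edges; apply/H/imset_f.
by rewrite mem_edges; have := H _ Ax; rewrite inE.
Qed.

Lemma mem_star v A x : ([set v; x] \in star v A) = (x \in A).
Proof.
apply/imsetP/idP => [[y Ay /set2_inj->//]|Ax]; by exists x.
Qed.

Lemma star_inj v w A B : 1 < #|A| -> star v A = star w B -> v = w /\ A = B.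
Proof.
move=> A1 E; have vw : v = w.
  have inw e : e \in star v A -> w \in e.
    by rewrite E => /imsetP[b _ ->]; rewrite set21.
  case/card_gt1P: A1 => x [y [Ax Ay xy]].
  have /inw := imset_f (fun x => [set v; x]) Ax.
  have /inw := imset_f (fun x => [set v; x]) Ay.
  rewrite !inE => /orP[/eqP->//|/eqP wy] /orP[/eqP->//|/eqP wx].
  by rewrite -wx wy eqxx in xy.
by split=> //; apply/setP=> x; rewrite -(mem_star v) E vw mem_star.
Qed.

Lemma num_stars_sum t G : 1 < t -> num_stars t G = \sum_(v : T) 'C(deg G v, t).
Proof.
move=> t1; pose P := [set p : T * {set T} | (p.2 \subset nbhd G p.1) && (#|p.2| == t)].
have -> : num_stars t G = #|[set star p.1 p.2 | p in P]|.
  apply: eq_card => F; rewrite inE; apply/andP/imsetP.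
    case=> FG /existsP[v /existsP[A /and3P[_ At /eqP EF]]].
    by exists (v, A) => //; rewrite inE At andbT -star_sub -EF.
  case=> -[v A]; rewrite inE /= => /andP[AN At] ->; split; first by rewrite star_sub.
  apply/existsP; exists v; apply/existsP; exists A; rewrite At eqxx !andbT.
  by apply: contraTN AN => vA; apply/subsetPn; exists v; rewrite // inE adj_irr.
rewrite card_in_imset; last first.
  move=> [v A] [w B]; rewrite inE /= => /andP[_ /eqP At] _ /star_inj.
  by rewrite At => /(_ t1)[-> ->].
rewrite -sum1_card (partition_big (fun p => p.1) xpredT) //=.
apply: eq_bigr => v _; rewrite /deg -(cards_draws (nbhd G v) t) -sum1_card.
rewrite (reindex_onto (fun A => (v, A)) (fun p => p.2)) /=.
  by apply: eq_bigl => A; rewrite !inE /= !eqxx !andbT.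
by move=> [w A] /= /andP[_ /eqP->].
Qed.

Lemma num_stars1 G : num_stars 1 G = #|edges G|.
Proof.
rewrite -(card_imset (mem (edges G)) (@set1_inj _)).
apply: eq_card => F; rewrite inE; apply/andP/imsetP.
  case=> FG /existsP[v /existsP[A /and3P[_ /cards1P[x ->] /eqP EF]]].
  exists [set v; x]; last by rewrite EF /star imset_set1.
  by apply: (subsetP FG); rewrite EF mem_star set11.
case=> e eG ->; split; first by rewrite sub1set.
case/imsetP: eG => -[x y]; rewrite inE /= => Gxy ->.
apply/existsP; exists x; apply/existsP; exists [set y].
rewrite cards1 /star imset_set1 !eqxx !andbT inE.
by apply: contraTneq Gxy => ->; rewrite adj_irr.
Qed.

Lemma handshake G : (\sum_(v : T) deg G v) = 2 * #|edges G|.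
Proof.
transitivity #|[set e : T * T | G e.1 e.2]|.
  rewrite -[RHS]sum1_card (partition_big (fun p => p.1) xpredT) //=.
  apply: eq_bigr => v _; rewrite /deg -sum1_card.
  rewrite [RHS](reindex_onto (fun x => (v, x)) (fun p => p.2)) /=.
    by apply: eq_bigl => x; rewrite !inE /= !eqxx !andbT.
  by move=> [w x] /= /andP[_ /eqP->].
rewrite -sum1_card (partition_big (fun e => [set e.1; e.2]) (mem (edges G))) /=; last first.
  by move=> e; rewrite inE => Ge; rewrite mem_edges.
rewrite mulnC -sum_nat_const; apply: eq_bigr => e /imsetP[[x y]].
rewrite inE /= => Gxy ->.
have xy : x != y by apply: contraTneq Gxy => ->; rewrite adj_irr.
have <- : #|[set (x, y); (y, x)]| = 2.
  by rewrite cards2 xpair_eqE negb_and xy.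
rewrite -sum1_card; apply: eq_bigl => -[a b]; rewrite !inE /= !xpair_eqE.
apply/andP/orP => [[Gab /eqP E]|].
  have := set21 a b; rewrite E !inE => /orP[]/eqP Ea; rewrite Ea !eqxx /=.
    by left; rewrite Ea in E; rewrite (set2_inj E).
  by right; move: E; rewrite Ea [RHS]setUC => /set2_inj->.
by case=> /andP[/eqP-> /eqP->]; split; rewrite // 1?adj_sym // setUC.
Qed.

End Stars.

Definition complete_adj (m : nat) : rel 'I_m := [rel x y | x != y].

Fact complete_sym m : symmetric (@complete_adj m).
Proof. by move=> x y; rewrite /complete_adj /= eq_sym. Qed.

Fact complete_irr m : irreflexive (@complete_adj m).
Proof. by move=> x; rewrite /complete_adj /= eqxx. Qed.

Definition complete (m : nat) : sgraph 'I_m :=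
  SGraph (@complete_sym m) (@complete_irr m).

Section UnionJoin.
Variables (T U : finType) (A : sgraph T) (B : sgraph U).

(* The Boolean tells whether all edges between the two parts are present. *)
Definition sum_adj (b : bool) : rel (T + U) := fun x y =>
  match x, y with
  | inl x, inl y => A x y
  | inr x, inr y => B x y
  | _, _ => b
  end.

Fact sum_sym b : symmetric (sum_adj b).
Proof. by move=> [x|x] [y|y] //=; rewrite adj_sym. Qed.

Fact sum_irr b : irreflexive (sum_adj b).
Proof. by move=> [x|x] /=; rewrite adj_irr. Qed.

Definition gunion : sgraph (T + U)%type := SGraph (sum_sym false) (sum_irr false).

Definition gjoin : sgraph (T + U)%type := SGraph (sum_sym true) (sum_irr true).
End UnionJoin.

(* H_n^k(i), for 1 <= k <= n - 2 and 1 <= i <= (n - k + 1) / 2; no subtraction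
   is truncated in this range. For k = 1 the factor K_0 is empty, leaving
   K_i U K_(n - i). *)
Definition H_graph (n k i : nat) :
    sgraph ('I_(k - 1) + ('I_i + 'I_(n - k - i + 1)))%type :=
  gjoin (complete (k - 1)) (gunion (complete i) (complete (n - k - i + 1))).

(* The truncated d + 2 - k is 0 when d - k + 2 < 0, which leaves the maximum
   with 1 unchanged. *)
Definition i_min (k d : nat) : nat := maxn 1 (d + 2 - k).

Definition i_max (n k : nat) : nat := (n - k + 1) %/ 2.

Definition star_bound (n k d t : nat) : nat :=
  if t == 1 then num_stars t (H_graph n k (i_min k d))
  else maxn (num_stars t (H_graph n k (i_min k d)))
            (num_stars t (H_graph n k (i_max n k))).

(* Main.v *)
(** A disconnecting set of fewer than k vertices leaves nonempty sets A, B with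
    no edge between them; they can be shrunk so that |A| + |B| = n - k + 1.
    Vertices of A then have degree at most n - 1 - |B|, and symmetrically, so
    the degree sequence of G is dominated by that of H_n^k(|A|), and
    |A|, |B| >= i_d. The degree sum of H_n^k(a) is, up to a constant,
    f(a) + f(n - k + 1 - a) with f(a) = a * C(k - 2 + a, t) convex, hence it is
    largest at the extreme value a = i_d. *)
Require Import Defs.
From mathcomp Require Import all_boot zify.

Set Implicit Arguments.
Unset Strict Implicit.
Unset Printing Implicit Defensive.

Lemma leq_min_degree (T : finType) (G : sgraph T) d :
  reflect (d <= #|T| /\ forall v, d <= deg G v) (d <= min_degree G).
Proof.
rewrite /min_degree; apply: (iffP idP) => [dG|[dT dG]]; last first.
  by apply: (big_ind (leq d)) => // x y dx dy; rewrite leq_min dx.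
have le_big (s : seq T) : d <= \big[minn/#|T|]_(v <- s) deg G v ->
    d <= #|T| /\ {in s, forall v, d <= deg G v}.
  elim: s => [|u s IHs]; first by rewrite big_nil.
  rewrite big_cons leq_min => /andP[du /IHs[dT ds]]; split=> // v.
  by rewrite inE => /predU1P[->|/ds].
by have [dT dv] := le_big _ dG; split=> // v; apply: dv; rewrite mem_index_enum.
Qed.

(* An edge is a 1-star about each of its two ends, whence the factor. *)
Lemma sum_bin_deg (T : finType) (G : sgraph T) t : 0 < t ->
  \sum_(v : T) 'C(deg G v, t) = (if t == 1 then 2 else 1) * num_stars t G.
Proof.
move=> t_gt0; case: eqP => [->|/eqP t_neq1]; last first.
  by rewrite mul1n num_stars_sum // ltn_neqAle eq_sym t_neq1.
by rewrite num_stars1 -handshake; apply: eq_bigr => v _; rewrite bin1.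
Qed.

Section Separation.
Variables (T : finType) (G : sgraph T).

Lemma deg_separated (B : {set T}) v :
  v \notin B -> (forall w, w \in B -> ~~ G v w) -> deg G v <= #|T| - 1 - #|B|.
Proof.
move=> vB nGB.
have: nbhd G v \subset ~: (v |: B).
  apply/subsetP => w; rewrite !inE negb_or => Gvw; apply/andP; split.
    by apply: contraTneq Gvw => ->; rewrite adj_irr.
  by apply: contraTN Gvw => /nGB.
move/subset_leq_card; rewrite -/(deg G v).
have := cardsC (v |: B); rewrite cardsU1 vB /=; lia.
Qed.

Lemma not_k_connected_separation k : 0 < k < #|T| -> ~~ k_connected k G ->
  exists A B : {set T}, [/\ A != set0, B != set0, [disjoint A & B],
    #|T| - k + 1 <= #|A| + #|B| &
    forall x y, x \in A -> y \in B -> ~~ G x y].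
Proof.
move=> /andP[k0 kT]; rewrite /k_connected kT /= negb_forall.
case/existsP=> S; rewrite negb_imply => /andP[Sk].
rewrite negb_forall => /existsP[x]; rewrite negb_forall => /existsP[y nxy].
(* [A] is the component of [x] in [G - S]; the other side is everything outside [A] and [S].
   Together they miss only [S], which has fewer than [k] vertices. *)
pose A := [set val z | z in connect (induced G (~: S)) x].
have memA z : (val z \in A) = connect (induced G (~: S)) x z.
  by rewrite mem_imset //; apply: val_inj.
have AS : [disjoint A & S].
  rewrite disjoints_subset; apply/subsetP=> _ /imsetP[z _ ->]; exact: valP.
exists A, (~: (A :|: S)); split.
- by apply/set0Pn; exists (val x); rewrite memA connect0.
- apply/set0Pn; exists (val y); rewrite !inE negb_or memA nxy /=.
  by have := valP y; rewrite inE.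
- by rewrite disjoints_subset setCK subsetUl.
- move: kT; rewrite -(cardsC (A :|: S)) cardsU (disjoint_setI0 AS) cards0.
  by clearbody A; lia.
move=> _ v /imsetP[z xz ->]; rewrite !inE negb_or => /andP[vA vS].
have vS' : v \in ~: S by rewrite inE.
apply: contra vA => Gzv; rewrite -[v]/(val (exist (fun v => v \in ~: S) v vS')).
by rewrite memA (connect_trans xz) // connect1.
Qed.

End Separation.

Lemma exists_subset_card (T : finType) (A : {set T}) m :
  m <= #|A| -> exists2 B : {set T}, B \subset A & #|B| = m.
Proof.
rewrite -bin_gt0 -cards_draws card_gt0 => /set0Pn[B].
by rewrite inE => /andP[BA /eqP]; exists B.
Qed.

(* The degree sum over the two cliques K_a and K_b of K_c + (K_a U K_b). *)
Definition clique_sum c t a b := a * 'C(c + a - 1, t) + b * 'C(c + b - 1, t).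

Lemma clique_sumC c t a b : clique_sum c t a b = clique_sum c t b a.
Proof. exact: addnC. Qed.

(** Discrete derivative, by Pascal's rule, of the function whose convexity is needed: the increment
    is visibly nondecreasing in [a]. At [a = 0] a truncated [c + a - 1] is harmless, being
    multiplied by 0. *)
Lemma mul_bin_incr c t a : 0 < t ->
  a.+1 * 'C(c + a.+1 - 1, t) =
  a * 'C(c + a - 1, t) + ('C(c + a, t) + a * 'C(c + a - 1, t.-1)).
Proof.
case: t => // t _; rewrite addnS subn1 /=.
case: a => [|a]; first by rewrite addn0 mul1n !mul0n addn0.
rewrite addnS subn1 /= binS; lia.
Qed.

(** Convexity: the increment of the summand at [a] is at most its increment at [b]. *)
Lemma clique_sum_shift c t a b : 0 < t -> a <= b ->
  clique_sum c t a.+1 b <= clique_sum c t a b.+1.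
Proof.
move=> t0 ab; rewrite /clique_sum !mul_bin_incr // -addnA leq_add2l.
rewrite addnC leq_add2l leq_add ?leq_mul //; apply: leq_bin2l; lia.
Qed.

(** Vertices move one at a time from the smaller clique to the larger, never lowering the sum, until
    the smaller has size [i]. *)
Lemma clique_sum_extreme c t i a b : 0 < t -> i <= a -> i <= b ->
  clique_sum c t a b <= clique_sum c t i (a + b - i).
Proof.
move=> t0; wlog ab : a b / a <= b.
  move=> W ia ib; case: (leqP a b) => [|/ltnW] ab; first exact: W.
  by rewrite clique_sumC addnC W.
move=> ia ib; elim: a b ia ab {ib} => [|a IHa] b ia ab.
  by move: ia; rewrite leqn0 => /eqP->; rewrite subn0.
move: ia; rewrite leq_eqVlt => /predU1P[->|ia]; first by rewrite addKn.
have ab' : a <= b by apply: ltnW.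
apply: (leq_trans (clique_sum_shift c t0 ab')).
by rewrite addSnnS IHa // leqW.
Qed.

Section DegreeSums.
Variables (T U : finType) (A : sgraph T) (B : sgraph U).

Lemma deg_sum (V W : finType) (K : sgraph (V + W)%type) v :
  deg K v = #|[set x | K v (inl x)]| + #|[set y | K v (inr y)]|.
Proof.
by rewrite /deg /nbhd -!sum1dep_card big_sumType.
Qed.

Lemma deg_joinl x : deg (gjoin A B) (inl x) = deg A x + #|U|.
Proof. by rewrite deg_sum /= -cardsT. Qed.

Lemma deg_joinr y : deg (gjoin A B) (inr y) = #|T| + deg B y.
Proof. by rewrite deg_sum /= -cardsT. Qed.

Lemma deg_unionl x : deg (gunion A B) (inl x) = deg A x.
Proof. by rewrite deg_sum /= [X in _ + X]cards0 addn0. Qed.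

Lemma deg_unionr y : deg (gunion A B) (inr y) = deg B y.
Proof. by rewrite deg_sum /= [X in X + _]cards0. Qed.

End DegreeSums.

Lemma deg_complete m (x : 'I_m) : deg (complete m) x = m.-1.
Proof.
have -> : deg (complete m) x = #|[set~ x]|.
  by apply: eq_card => y; rewrite !inE eq_sym.
by rewrite cardsC1 card_ord.
Qed.

Definition deg_H := (deg_joinl, deg_joinr, deg_unionl, deg_unionr, deg_complete,
  card_sum, card_ord).

Section HGraph.
Variables n k i : nat.
Hypotheses (hk : 1 <= k <= n - 2) (hi : 1 <= i <= i_max n k).

Lemma card_H : #|{: 'I_(k - 1) + ('I_i + 'I_(n - k - i + 1))}| = n.
Proof. by move: hi; rewrite /i_max !card_sum !card_ord; lia. Qed.

Lemma sum_bin_deg_H t : \sum_v 'C(deg (H_graph n k i) v, t) =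
  (k - 1) * 'C(n - 1, t) + clique_sum (k - 1) t i (n - k + 1 - i).
Proof.
move: hi; rewrite /i_max => hi'; rewrite !big_sumType /=; congr (_ + (_ + _)).
- rewrite -[X in _ = X * _]card_ord -sum_nat_const; apply: eq_bigr => v _.
  (* The existence of [v] gives [k - 1 > 0], so the predecessor in its clique degree is not
     truncated. *)
  rewrite !deg_H; congr 'C(_, _); have := ltn_ord v; lia.
- under eq_bigr => v _ do rewrite !deg_H.
  rewrite sum_nat_const card_ord; congr (_ * 'C(_, _)); lia.
- under eq_bigr => v _ do rewrite !deg_H.
  rewrite sum_nat_const card_ord; congr (_ * 'C(_, _)); lia.
Qed.

Lemma min_degree_H d : i_min k d <= i -> d <= min_degree (H_graph n k i).
Proof.
move: hi; rewrite /i_max /i_min => hi' di; apply/leq_min_degree.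
rewrite card_H; split; first by lia.
(* The smallest degree, [k - 2 + i], occurs on K_i, since [i <= i_max n k] makes the other clique no
   smaller. *)
by move=> [v|[v|v]]; rewrite !deg_H; have := ltn_ord v; lia.
Qed.

Lemma H_not_k_connected : ~~ k_connected k (H_graph n k i).
Proof.
move: hi; rewrite /i_max => hi'; rewrite /k_connected negb_and.
apply/orP; right; rewrite negb_forall.
(* The cut is the joined clique K_(k-1). *)
pose S := [set inl z | z : 'I_(k - 1)] : {set 'I_(k - 1) + ('I_i + 'I_(n - k - i + 1))}.
apply/existsP; exists S; rewrite negb_imply; apply/andP; split.
  by rewrite card_imset ?card_ord; [lia | move=> ? ? []].
have inS y : inr y \in ~: S.
  by rewrite inE; apply/imsetP => -[].
have i0 : 0 < i by lia.
have j0 : 0 < n - k - i + 1 by lia.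
rewrite negb_forall; apply/existsP; exists (exist (fun v => v \in ~: S) _ (inS (inl (Ordinal i0)))).
rewrite negb_forall; apply/existsP; exists (exist (fun v => v \in ~: S) _ (inS (inr (Ordinal j0)))).
(* [P] marks the vertices of K_i. Once [S] is deleted no edge leaves them, so no path reaches the
   other clique. *)
pose P := [pred z : {z | z \in ~: S} | if val z is inr (inl _) then true else false].
have closedP : closed (induced (H_graph n k i) (~: S)) P.
  have inlS u : inl u \in ~: S = false by rewrite inE imset_f.
  by move=> [[u|[u|u]] Su] [[v|[v|v]] Sv] //=;
    first [have := inlS u | have := inlS v]; rewrite ?Su ?Sv.
by apply/negP => /(closed_connect closedP).
Qed.

End HGraph.

Lemma sum_bin_deg_bound (n k d t : nat) (T : finType) (G : sgraph T) :
  1 <= k <= n - 2 -> 0 < t -> #|T| = n -> d <= min_degree G ->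
  ~~ k_connected k G ->
  \sum_(v : T) 'C(deg G v, t) <=
  (k - 1) * 'C(n - 1, t) +
  clique_sum (k - 1) t (i_min k d) (n - k + 1 - i_min k d).
Proof.
move=> hk t0 Tn /leq_min_degree[_ dG] /not_k_connected_separation[|A0 [B0]]; first by lia.
rewrite -!card_gt0 => -[A0_gt0 B0_gt0 AB0 cAB0 nG0].
(* The cap [n - k] leaves at least one vertex for [B] when the sizes are made to add up to
   [n - k + 1]. *)
have [A AA0 cA] : exists2 A : {set T}, A \subset A0 & #|A| = minn #|A0| (n - k).
  exact/exists_subset_card/geq_minl.
have [B BB0 cB] : exists2 B : {set T}, B \subset B0 & #|B| = n - k + 1 - #|A|.
  by apply: exists_subset_card; lia.
have AB : [disjoint A & B] by rewrite (disjointWl AA0) // (disjointWr BB0).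
have degA v : v \in A -> deg G v <= k - 1 + #|A| - 1.
  move=> vA; apply: (leq_trans (deg_separated (negbT (disjointFr AB vA)) _)).
    by move=> w wB; rewrite nG0 ?(subsetP AA0) ?(subsetP BB0).
  lia.
have degB v : v \in B -> deg G v <= k - 1 + #|B| - 1.
  move=> vB; apply: (leq_trans (deg_separated (negbT (disjointFl AB vB)) _)).
    by move=> w wA; rewrite adj_sym nG0 ?(subsetP AA0) ?(subsetP BB0).
  lia.
(* A vertex of [A] has degree at least [d] and at most [k - 2 + #|A|]. *)
have iA : i_min k d <= #|A|.
  have /card_gt0P[v vA] : 0 < #|A| by lia.
  have := leq_trans (dG v) (degA v vA); rewrite /i_min; lia.
have iB : i_min k d <= #|B|.
  have /card_gt0P[v vB] : 0 < #|B| by lia.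
  have := leq_trans (dG v) (degB v vB); rewrite /i_min; lia.
have cAB : #|A| + #|B| = n - k + 1 by lia.
rewrite -cAB; apply: leq_trans (leq_add (leqnn _) (clique_sum_extreme _ t0 iA iB)).
have cC : #|~: (A :|: B)| = k - 1.
  have := cardsC (A :|: B); rewrite cardsU (disjoint_setI0 AB) cards0; lia.
have bound (C : {set T}) m : (forall v, v \in C -> deg G v <= m) ->
    \sum_(v in C) 'C(deg G v, t) <= #|C| * 'C(m, t).
  by move=> Cm; rewrite -sum_nat_const leq_sum // => v /Cm; apply: leq_bin2l.
(* The [k - 1] vertices outside [A] and [B] get the trivial degree bound [n - 1], which is
   [deg_separated] for the empty set. *)
rewrite (bigID (mem (A :|: B))) /= addnC leq_add //.
  under eq_bigl do rewrite -in_setC.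
  rewrite -cC bound // => v _; rewrite -Tn.
  by have := @deg_separated _ G set0 v; rewrite cards0 subn0; apply => [|w]; rewrite inE.
rewrite (eq_bigl [predU A & B]) => [|v]; last by rewrite !inE.
by rewrite bigU //= leq_add // bound.
Qed.

Theorem theorem6 (n k d t : nat)
    (hn : 3 <= n) (hk : 1 <= k <= n - 2)
    (hd : 2 * d <= n + k - 3) (ht : 1 <= t <= n - 1) :
  (forall (T : finType) (G : sgraph T),
     #|T| = n -> d <= min_degree G -> ~~ k_connected k G ->
     num_stars t G <= star_bound n k d t) /\
  (exists (T : finType) (G : sgraph T),
     [/\ #|T| = n, d <= min_degree G, ~~ k_connected k G &
         num_stars t G = star_bound n k d t]).
Proof.
have t0 : 0 < t by case/andP: ht.
(* The hypothesis [hd] says exactly that [d - k + 2 <= (n - k + 1) / 2]. *)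
have hi : 1 <= i_min k d <= i_max n k by rewrite /i_min /i_max; lia.
have hi0 : 1 <= i_max n k <= i_max n k by lia.
split=> [T G Tn dG nkG|].
  apply: (@leq_trans (num_stars t (H_graph n k (i_min k d)))); last first.
    by rewrite /star_bound; case: ifP => // _; apply: leq_maxl.
  have := sum_bin_deg_bound hk t0 Tn dG nkG.
  (* Both degree sums count stars with the same factor, 2 or 1, which cancels. *)
  by rewrite -sum_bin_deg_H // !sum_bin_deg // leq_pmul2l //; case: ifP.
(* Equality is attained by whichever of the two graphs realizes [star_bound]. *)
suff [i [ki ik ->]] : exists i, [/\ i_min k d <= i, i <= i_max n k &
    star_bound n k d t = num_stars t (H_graph n k i)].
  have hik : 1 <= i <= i_max n k by lia.
  exists _, (H_graph n k i); split=> //; first exact: card_H.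
    exact: min_degree_H.
  exact: H_not_k_connected.
have [_ hi_max] := andP hi.
rewrite /star_bound /maxn; case: ifP => _; last case: ifP => _.
- by exists (i_min k d).
- by exists (i_max n k).
- by exists (i_min k d).
Qed.
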